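(* Let $N=\{1,\dots,n\}$, let $G=(N,E)$ be an undirected connected graph, let $w_{ij}\ge 0$ for $i,j\in N$, and let $p\in\{2,\dots,n-1\}$, $q\in\{1,\dots,p-1\}$. Let $O_i$ and $O_{ikm}$ be the constants, and (DTHLPU) the mixed integer linear program, defined in the context. Then the following inequalities are valid for (DTHLPU), i.e. every feasible solution $(z,t,y,y',y'',x,x',x'')$ of (DTHLPU) satisfies them: 1) $x_{ikm}+x_{imk}+x'_{ikm}+x'_{imk}+x''_{ikm}+x''_{imk}\le O_{ikm}\,z_{kk}$ for all $i,k,m\in N$ with $i\ne k$, $k<m$, $\{k,m\}\in E$; 2) $x_{ikm}+x_{imk}+x'_{ikm}+x'_{imk}+x''_{ikm}+x''_{imk}\le O_{ikm}\,z_{mm}$ for all $i,k,m\in N$ with $i\ne k$, $k<m$, $\{k,m\}\in E$; 3) $x_{iim}+x'_{iim}+x''_{iim}\le O_{iim}\,z_{ii}$ for all $i,m\in N$ with $m\ne i$, $\{i,m\}\in E$; 4) $x_{iim}+x'_{iim}+x''_{iim}\le O_{iim}\,z_{mm}$ for all $i,m\in N$ with $m\ne i$, $\{i,m\}\in E$; 5) $y_{km}+y'_{km}+y''_{km}+z_{km}+z_{mk}\le 1$ for all $k,m\in N$ with $k<m$, $\{k,m\}\in E$.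
   Context: Data. $N=\{1,\dots,n\}$; $G=(N,E)$ is an undirected connected graph, and edges $\{k,m\}\in E$ used below have $k\neq m$; $w_{ij}\ge 0$ is the flow to be sent from $i$ to $j$ ($i,j\in N$, including $i=j$); $p\in\{2,\dots,n-1\}$ is the number of hubs to locate; $q\in\{1,\dots,p-1\}$ is the number of hubs to upgrade. Constants. $O_i=\sum_{j\in N}w_{ij}$ is the total flow sent from origin $i$. For $i\in N$ and $k\neq m\in N$, $$O_{ikm}=\begin{cases}O_i-w_{ii}-\min\{w_{ik},w_{im}\}&\text{if } i\ne k,\\ O_i-w_{ii}&\text{if } i=k,\end{cases}$$ so in particular $O_{iim}=O_i-w_{ii}$. Variables of (DTHLPU) (the disaggregated formulation of the Tree of Hubs Location Problem with Upgrading). Binary: $z_{ik}$ for $i,k\in N$ (for $i\ne k$: node $i$ is allocated to hub $k$; $z_{kk}=1$: $k$ is a hub); $t_k$ for $k\in N$ ($k$ is an upgraded hub); $y_{km},y'_{km},y''_{km}$ for $k<m$, $\{k,m\}\in E$ ($k$ and $m$ are adjacent hubs in the tree of hubs with, respectively, none, exactly one, or both of them upgraded). Continuous and nonnegative: $x_{ikm},x'_{ikm},x''_{ikm}$ for $i\in N$ and ordered pairs $(k,m)$ with $k\ne m$, $\{k,m\}\in E$ (flow with origin $i$ traversing the arc $(k,m)$ between hubs with, respectively, none, exactly one, or both of them upgraded). Constraints of (DTHLPU). A feasible solution is an assignment of values to these variables, respecting the binary and nonnegativity requirements, such that: - $\sum_{k\in N}z_{kk}=p$; - $\sum_{k<m,\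 \{k,m\}\in E}(y_{km}+y'_{km}+y''_{km})=p-1$; - $\sum_{k\in N}z_{ik}=1$ for all $i\in N$; - $y_{km}+y'_{km}+y''_{km}+z_{mk}\le z_{kk}$ for all $k<m$, $\{k,m\}\in E$; - $y_{km}+y'_{km}+y''_{km}+z_{km}\le z_{mm}$ for all $k<m$, $\{k,m\}\in E$; - $\sum_{k\in N}t_k=q$, and $t_k\le z_{kk}$ for all $k\in N$; - $y''_{km}\le t_k$, $\ y''_{km}\le t_m$, $\ y'_{km}+y''_{km}\le t_k+t_m$ for all $k<m$, $\{k,m\}\in E$; - $x_{ikm}+x_{imk}\le O_{ikm}y_{km}$, $\ x'_{ikm}+x'_{imk}\le O_{ikm}y'_{km}$, $\ x''_{ikm}+x''_{imk}\le O_{ikm}y''_{km}$ for all $i,k,m\in N$ with $i\ne k$, $k<m$, $\{k,m\}\in E$; - $x_{iim}\le O_{iim}\,y_{\min\{i,m\},\max\{i,m\}}$, $\ x'_{iim}\le O_{iim}\,y'_{\min\{i,m\},\max\{i,m\}}$, $\ x''_{iim}\le O_{iim}\,y''_{\min\{i,m\},\max\{i,m\}}$ for all $i,m\in N$ with $\{i,m\}\in E$; - $O_iz_{ik}+\sum_{m:\{k,m\}\in E}(x_{imk}+x'_{imk}+x''_{imk})=\sum_{m:\{k,m\}\in E}(x_{ikm}+x'_{ikm}+x''_{ikm})+\sum_{j\in N}w_{ij}z_{jk}$ for all $i,k\in N$. The (linear, cost-minimizing) objective function of (DTHLPU) plays no role in which solutions are feasible. *)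

(* Defs.v *)
From mathcomp Require Import all_boot all_order all_algebra.

Set Implicit Arguments.
Unset Strict Implicit.
Unset Printing Implicit Defensive.

Import Order.TTheory GRing.Theory Num.Theory.
Local Open Scope ring_scope.

(* Nodes are ['I_n], i.e. 0, ..., n-1 in place of 1, ..., n, with the same
   order.  A possible loop of the edge relation is never used as an edge. *)
Definition edge (n : nat) (E : rel 'I_n) (k m : 'I_n) : bool :=
  (k != m) && E k m.

Definition connected_graph (n : nat) (E : rel 'I_n) : Prop :=
  forall k m : 'I_n, connect E k m.

Definition origin_flow (R : realFieldType) (n : nat) (w : 'I_n -> 'I_n -> R)
    (i : 'I_n) : R :=
  \sum_(j < n) w i j.

Definition arc_bound (R : realFieldType) (n : nat) (w : 'I_n -> 'I_n -> R)
    (i k m : 'I_n) : R :=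
  if i != k then origin_flow w i - w i i - Num.min (w i k) (w i m)
  else origin_flow w i - w i i.

Definition binary (R : realFieldType) (a : R) : Prop := a = 0 \/ a = 1.

(* Feasibility for the mixed integer program (DTHLPU), the disaggregated
   formulation of the Tree of Hubs Location Problem with Upgrading.
   The variables are total functions; their values outside the index sets of
   the program (y, y', y'' : edges with k < m; x, x', x'' : arcs of the graph)
   are unconstrained and occur in no constraint. *)
Record DTHLPU_feasible (R : realFieldType) (n : nat) (E : rel 'I_n)
    (w : 'I_n -> 'I_n -> R) (p q : nat)
    (z : 'I_n -> 'I_n -> R) (t : 'I_n -> R) (y y' y'' : 'I_n -> 'I_n -> R)
    (x x' x'' : 'I_n -> 'I_n -> 'I_n -> R) : Prop := {
  z_binary : forall i k : 'I_n, binary (z i k);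
  t_binary : forall k : 'I_n, binary (t k);
  y_binary : forall k m : 'I_n, (k < m)%N -> edge E k m ->
    [/\ binary (y k m), binary (y' k m) & binary (y'' k m)];
  x_nonneg : forall i k m : 'I_n, edge E k m ->
    [/\ 0 <= x i k m, 0 <= x' i k m & 0 <= x'' i k m];
  hub_count : \sum_(k < n) z k k = p%:R;
  tree_edge_count :
    \sum_(k < n) \sum_(m < n | (k < m)%N && edge E k m)
      (y k m + y' k m + y'' k m) = (p - 1)%:R;
  single_allocation : forall i : 'I_n, \sum_(k < n) z i k = 1;
  edge_hub_left : forall k m : 'I_n, (k < m)%N -> edge E k m ->
    y k m + y' k m + y'' k m + z m k <= z k k;
  edge_hub_right : forall k m : 'I_n, (k < m)%N -> edge E k m ->
    y k m + y' k m + y'' k m + z k m <= z m m;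
  upgrade_count : \sum_(k < n) t k = q%:R;
  upgrade_hub : forall k : 'I_n, t k <= z k k;
  edge_upgrade : forall k m : 'I_n, (k < m)%N -> edge E k m ->
    [/\ y'' k m <= t k, y'' k m <= t m & y' k m + y'' k m <= t k + t m];
  flow_bound : forall i k m : 'I_n, i != k -> (k < m)%N -> edge E k m ->
    [/\ x i k m + x i m k <= arc_bound w i k m * y k m,
        x' i k m + x' i m k <= arc_bound w i k m * y' k m
      & x'' i k m + x'' i m k <= arc_bound w i k m * y'' k m];
  origin_flow_bound : forall i m : 'I_n, edge E i m ->
    [/\ x i i m <= arc_bound w i i m * y (Order.min i m) (Order.max i m),
        x' i i m <= arc_bound w i i m * y' (Order.min i m) (Order.max i m)
      & x'' i i m <= arc_bound w i i m * y'' (Order.min i m) (Order.max i m)];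
  flow_conservation : forall i k : 'I_n,
    origin_flow w i * z i k
      + \sum_(m < n | edge E k m) (x i m k + x' i m k + x'' i m k)
    = \sum_(m < n | edge E k m) (x i k m + x' i k m + x'' i k m)
      + \sum_(j < n) w i j * z j k
}.

(* Main.v *)
Require Import Defs.
From mathcomp Require Import all_boot all_order all_algebra.
From mathcomp Require Import lra.
Import Order.TTheory GRing.Theory Num.Theory.
Local Open Scope ring_scope.

(** The disaggregated flow bounds hold for each of the three types of edge
    (no, one or two upgraded ends) separately.  Added up, they bound the total
    flow on an edge [{k, m}] by [O_ikm * Y_km], where [Y_km] is the sum of
    [y_km], [y'_km] and [y''_km].  The hub constraints
    [Y_km + z_mk <= z_kk] and [Y_km + z_km <= z_mm] give
    [Y_km <= z_kk] and [Y_km <= z_mm], because [z >= 0]; multiplying by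
    [O_ikm], which is nonnegative ([arc_bound_ge0]), yields the four flow
    inequalities.  In the last inequality, [Y_km + z_mk] is at most [z_kk],
    and [z_kk + z_km <= 1] because node [k] is allocated exactly once. *)

Lemma edge_sym (n : nat) (E : rel 'I_n) :
  symmetric E -> symmetric (edge E).
Proof. by move=> E_sym k m; rewrite /edge eq_sym E_sym. Qed.

Lemma ler_two_terms_sum (R : numDomainType) (I : finType) (f : I -> R)
    (i j : I) :
  (forall l, 0 <= f l) -> i != j -> f i + f j <= \sum_l f l.
Proof.
move=> f_ge0 ij; rewrite (bigD1 i) //= (bigD1 j) 1?eq_sym //= lerD2l lerDl.
exact: sumr_ge0.
Qed.

(** The terms subtracted from [O_i] are bounded by two different summands of
    [O_i]: the minimum is at most [w i k], and [i != k] whenever it occurs.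
    This covers [i = m] too. *)
Lemma arc_bound_ge0 (R : realFieldType) (n : nat) (w : 'I_n -> 'I_n -> R)
    (i k m : 'I_n) :
  (forall i j, 0 <= w i j) -> 0 <= arc_bound w i k m.
Proof.
move=> w_ge0; rewrite /arc_bound /origin_flow; case: ifP => [ik|_].
  have two : w i i + w i k <= \sum_j w i j by exact: ler_two_terms_sum.
  have min_le : Num.min (w i k) (w i m) <= w i k by rewrite ge_min lexx.
  lra.
rewrite (bigD1 i) //= addrAC subrr add0r.
exact: sumr_ge0.
Qed.

Lemma binary_ge0 (R : realFieldType) (a : R) : binary a -> 0 <= a.
Proof. by case=> ->. Qed.

Theorem lemma1 (R : realFieldType) (n : nat) (E : rel 'I_n)
    (w : 'I_n -> 'I_n -> R) (p q : nat)
    (E_sym : symmetric E) (E_conn : connected_graph E)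
    (w_ge0 : forall i j : 'I_n, 0 <= w i j)
    (p_range : (2 <= p <= n - 1)%N) (q_range : (1 <= q <= p - 1)%N)
    (z : 'I_n -> 'I_n -> R) (t : 'I_n -> R) (y y' y'' : 'I_n -> 'I_n -> R)
    (x x' x'' : 'I_n -> 'I_n -> 'I_n -> R)
    (feas : DTHLPU_feasible E w p q z t y y' y'' x x' x'') :
  [/\ (forall i k m : 'I_n, i != k -> (k < m)%N -> edge E k m ->
        x i k m + x i m k + x' i k m + x' i m k + x'' i k m + x'' i m k
          <= arc_bound w i k m * z k k),
      (forall i k m : 'I_n, i != k -> (k < m)%N -> edge E k m ->
        x i k m + x i m k + x' i k m + x' i m k + x'' i k m + x'' i m k
          <= arc_bound w i k m * z m m),
      (forall i m : 'I_n, m != i -> edge E i m ->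
        x i i m + x' i i m + x'' i i m <= arc_bound w i i m * z i i),
      (forall i m : 'I_n, m != i -> edge E i m ->
        x i i m + x' i i m + x'' i i m <= arc_bound w i i m * z m m)
    & (forall k m : 'I_n, (k < m)%N -> edge E k m ->
        y k m + y' k m + y'' k m + z k m + z m k <= 1)].
Proof.
have z_ge0 i k : 0 <= z i k := binary_ge0 _ _ (z_binary feas i k).
have O_ge0 i k m : 0 <= arc_bound w i k m by exact: arc_bound_ge0.
pose Y k m := y k m + y' k m + y'' k m.
have Y_le_left (k m : 'I_n) : (k < m)%N -> edge E k m -> Y k m <= z k k.
  by move=> km e; apply: le_trans _ (edge_hub_left feas km e); rewrite lerDl.
have Y_le_right (k m : 'I_n) : (k < m)%N -> edge E k m -> Y k m <= z m m.
  by move=> km e; apply: le_trans _ (edge_hub_right feas km e); rewrite lerDl.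
have flow_le (i k m : 'I_n) : i != k -> (k < m)%N -> edge E k m ->
    x i k m + x i m k + x' i k m + x' i m k + x'' i k m + x'' i m k
      <= arc_bound w i k m * Y k m.
  move=> ik km e; have [b b' b''] := flow_bound feas ik km e.
  rewrite /Y !mulrDr; lra.
have origin_flow_le i m : edge E i m ->
    x i i m + x' i i m + x'' i i m
      <= arc_bound w i i m * Y (Order.min i m) (Order.max i m).
  move=> e; have [b b' b''] := origin_flow_bound feas e.
  rewrite /Y !mulrDr; lra.
(* The edge variables are indexed by increasing pairs, so the two ends of an
   edge leaving [i] exchange roles when [m < i]. *)
have Y_le_ends i m : edge E i m ->
    Y (Order.min i m) (Order.max i m) <= z i i /\
    Y (Order.min i m) (Order.max i m) <= z m m.
  move=> e; have [im|mi|im] := ltgtP i m.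
  - by split; [exact: Y_le_left | exact: Y_le_right].
  - have e' : edge E m i by rewrite edge_sym.
    by split; [exact: Y_le_right | exact: Y_le_left].
  - by move: e; rewrite /edge im eqxx.
split.
- move=> i k m ik km e; apply: le_trans (flow_le _ _ _ ik km e) _.
  by rewrite ler_wpM2l // Y_le_left.
- move=> i k m ik km e; apply: le_trans (flow_le _ _ _ ik km e) _.
  by rewrite ler_wpM2l // Y_le_right.
- move=> i m _ e; apply: le_trans (origin_flow_le _ _ e) _.
  by rewrite ler_wpM2l //; case: (Y_le_ends _ _ e).
- move=> i m _ e; apply: le_trans (origin_flow_le _ _ e) _.
  by rewrite ler_wpM2l //; case: (Y_le_ends _ _ e).
- move=> k m km e; have left := edge_hub_left feas km e.
  have [k_neq_m _] := andP e.
  have alloc : z k k + z k m <= 1.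
    by rewrite -(single_allocation feas k) ler_two_terms_sum.
  lra.
Qed.
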